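(* For every prime $p$ there exist a metabelian group $G$ of order $p^8$ and a subgroup $H \leq Z(G) \cap G'$ of order $p$ such that there is a $G$-invariant transversal for $H\backslash G$. (In particular, $G$ is finite, $H$ is abelian and admits a $G$-invariant transversal, but $H \cap G' \neq \{1\}$.)
   Context: $Z(G)$ denotes the center and $G'$ the commutator subgroup of $G$. For a subgroup $H \leq G$, $H\backslash G = \{Hg \mid g \in G\}$ is the set of right cosets, and a transversal for $H\backslash G$ is a set $T \subseteq G$ containing exactly one element of each coset in $H\backslash G$. A subset of $G$ is $G$-invariant if it is invariant under conjugation by all elements of $G$, i.e. it is a union of conjugacy classes of $G$. *)

(* Defs.v *)
From mathcomp Require Import all_boot all_fingroup all_solvable.

Set Implicit Arguments.
Unset Strict Implicit.
Unset Printing Implicit Defensive.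

Local Open Scope group_scope.

Definition metabelian (gT : finGroupType) (G : {set gT}) : bool :=
  abelian G^`(1).

Definition conj_invariant (gT : finGroupType) (G T : {set gT}) : Prop :=
  forall g, g \in G -> T :^ g = T.

(* [rcosets H G] is the set of cosets H :* g with g \in G; [is_transversal]
   asks that T be contained in G and meet each of them in exactly one element
   (it also records that they partition G, which always holds for H \subset G). *)
Definition rcoset_transversal (gT : finGroupType) (T H G : {set gT}) : bool :=
  is_transversal T (rcosets H G) G.

(* Main.v *)
Require Import Defs.
From HB Require Import structures.
From mathcomp Require Import all_boot all_fingroup all_solvable.
From mathcomp Require Import all_algebra ring.

(** For central H, a conjugation-invariant transversal exists as soon as no
    nontrivial element of H is a commutator [x, y] of two elements. In a group
    of class 2 with G/Z = V the commutators are the images of decomposable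
    bivectors, whereas G' contains their products: take V = F_p^4, let
    e0^e2 and e0^e3 vanish, and let H be spanned by e0^e1 + e2^e3; the Klein
    quadric (Pluecker relation) shows that no nonzero multiple of this bivector
    becomes decomposable modulo e0^e2 and e0^e3. Using the "upper triangular"
    bilinear cocycle instead of an alternating one covers p = 2 as well. *)

Local Open Scope group_scope.

Section InvariantTransversal.

Variables (gT : finGroupType) (G H : {group gT}).
Hypothesis cHG : H \subset 'Z(G).

Let sHG : H \subset G. Proof. exact: subset_trans cHG (center_sub G). Qed.

(** The union of the conjugation orbit of the coset of [x]: applying [repr] to it makes a choice
    that depends on the orbit alone. *)
Let cosets_class x := H * x ^: G.

Lemma central_conjg h g : h \in H -> g \in G -> h ^ g = h.
Proof.
move=> /(subsetP cHG)/centerP[_ Ch] Gg.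
by apply/conjg_fixP/commgP; apply: Ch.
Qed.

Lemma mem_cosets_class x : x \in cosets_class x.
Proof. by rewrite -{1}[x]mul1g mem_mulg ?group1 ?class_refl. Qed.

(** Conjugation fixes the central factor [h], so it can be absorbed into [H]. *)
Lemma cosets_class_conj x h g :
  h \in H -> g \in G -> cosets_class (h * x ^ g) = cosets_class x.
Proof.
move=> Hh Gg; apply/setP=> z.
apply/mulsgP/mulsgP => [] [k _ Hk /imsetP[g' Gg' ->] ->].
  exists (k * h) (x ^ (g * g')); rewrite ?groupM ?memJ_class ?groupM //.
  by rewrite conjMg (central_conjg _ _ Hh) // conjgM mulgA.
exists (k * h^-1) ((h * x ^ g) ^ (g^-1 * g')).
- by rewrite groupM ?groupV.
- by rewrite memJ_class ?groupM ?groupV.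
rewrite conjMg (central_conjg _ _ Hh) ?groupM ?groupV // -conjgM mulKVg.
by rewrite -mulgA mulKg.
Qed.

(* Each orbit of G on the cosets of H gets one conjugacy class, that of a
   chosen point of the union of the orbit; the hypothesis says that this class
   meets no coset twice. *)
Lemma exists_conj_invariant_transversal :
    (forall x y, x \in G -> y \in G -> [~ x, y] \in H -> [~ x, y] = 1) ->
  exists T : {set gT}, rcoset_transversal T H G /\ conj_invariant G T.
Proof.
move=> commH1.
exists [set y in G | y \in repr (cosets_class y) ^: G]; split.
  apply/and3P; split; first exact: rcosets_partition.
    by apply/subsetP=> y /[1!inE] /andP[].
  apply/forall_inP=> _ /rcosetsP[x Gx ->]; apply/cards1P.
  (* The chosen point has the form [h * x ^ g]; conjugating it by [g^-1] gives [h * x], a point of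
     its class in the coset of [x]. *)
  have /mulsgP[h z Hh /imsetP[g Gg ->] rE] := mem_repr _ (mem_cosets_class x).
  have Gh := subsetP sHG h Hh.
  have clE k : k \in H -> cosets_class (k * x) = cosets_class x.
    by move=> Hk; rewrite -{1}[x]conjg1 cosets_class_conj ?group1.
  have clr : h * x \in repr (cosets_class x) ^: G.
    apply/imsetP; exists g^-1; rewrite ?groupV // rE.
    by rewrite conjMg conjgK (central_conjg _ _ Hh) ?groupV.
  exists (h * x); apply/setP=> y; rewrite !inE; apply/idP/eqP=> [|->]; last first.
    by rewrite clE // clr groupM //= mem_mulg ?set11.
  case/andP=> /andP[Gy ycl] /rcosetP[k Hk yE].
  have: h * x \in y ^: G.
    by move: clr ycl; rewrite yE clE // => ? /class_eqP->.
  case/imsetP=> u Gu hxE.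
  (* Two conjugate points of one coset differ by a central factor, here [y ^ u = y * (h * k^-1)], so
     this factor is a commutator lying in [H]. *)
  have hkE : h * k^-1 = [~ y, u].
    have cyk : y * (h * k^-1) = h * k^-1 * y.
      have Hhk : h * k^-1 \in H by rewrite groupM ?groupV.
      by have /centerP[_ Cy] := subsetP cHG _ Hhk; rewrite (Cy y).
    apply: (mulgI y); rewrite cyk commgEl mulKVg -hxE yE.
    by rewrite -mulgA mulKg.
  have := commH1 y u Gy Gu; rewrite -hkE groupM ?groupV // => /(_ isT) hk1.
  by move/eqP: hk1; rewrite -eq_mulgV1 yE => /eqP->.
move=> g Gg; apply/setP=> y; rewrite mem_conjg !inE.
rewrite groupJr ?groupV //; congr (_ && _).
have -> : cosets_class (y ^ g^-1) = cosets_class y.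
  by rewrite -[_ ^ _]mul1g cosets_class_conj ?groupV ?group1.
by rewrite memJ_norm // (subsetP (class_norm _ _)) ?groupV.
Qed.

End InvariantTransversal.

Section CentralExtension.

Set Implicit Arguments.
Unset Strict Implicit.

Import GRing.Theory.
Local Open Scope ring_scope.

Variables (V W : finZmodType) (beta : V -> V -> W).
Hypothesis betaDl : forall u v x, beta (u + v) x = beta u x + beta v x.
Hypothesis betaDr : forall x u v, beta x (u + v) = beta x u + beta x v.

(** The proofs of bilinearity are arguments of the type so that the group instance can recover them
    from the type itself. *)
Definition bilinear_extension
  (_ : forall u v x, beta (u + v) x = beta u x + beta v x)
  (_ : forall x u v, beta x (u + v) = beta x u + beta x v) : Type := (V * W)%type.

Local Notation E := (bilinear_extension betaDl betaDr).

HB.instance Definition _ := Finite.on E.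

Definition bext_mul (x y : E) : E :=
  (x.1 + y.1, x.2 + y.2 + beta x.1 y.1).
Definition bext_one : E := (0, 0).
Definition bext_inv (x : E) : E := (- x.1, - x.2 + beta x.1 x.1).

Lemma beta0l x : beta 0 x = 0.
Proof. by apply: (addrI (beta 0 x)); rewrite -betaDl !addr0. Qed.

Lemma beta0r x : beta x 0 = 0.
Proof. by apply: (addrI (beta x 0)); rewrite -betaDr !addr0. Qed.

Lemma bext_mulA : associative bext_mul.
Proof.
move=> [a b] [c d] [e f]; congr pair => /=; first by rewrite addrA.
rewrite betaDl betaDr -!addrA; congr (_ + (_ + _)).
by rewrite [_ + (beta a c + _)]addrC -addrA addrCA.
Qed.

Lemma bext_mul1 : left_id bext_one bext_mul.
Proof. by case=> a b; rewrite /bext_mul /= beta0l !add0r addr0. Qed.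

Lemma bext_mulV : left_inverse bext_one bext_inv bext_mul.
Proof.
case=> a b; congr pair => /=; first by rewrite addNr.
by rewrite addrAC -[_ + _ + beta _ _]addrA -betaDl subrr beta0l addr0 addNr.
Qed.

HB.instance Definition _ :=
  Finite_isGroup.Build E bext_mulA bext_mul1 bext_mulV.

Lemma bext_mulE (x y : E) :
  (x * y)%g = (x.1 + y.1, x.2 + y.2 + beta x.1 y.1) :> E.
Proof. by []. Qed.

(** Compare with [x * y = y * x * [~ x, y]]: the cocycle vanishes on a zero first coordinate, so
    only the antisymmetrization of [beta] survives. *)
Lemma bext_commgE (x y : E) : [~ x, y] = (0, beta x.1 y.1 - beta y.1 x.1) :> E.
Proof.
apply: (mulgI (y * x)%g); rewrite -commgC !bext_mulE /= beta0r !addr0.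
by congr pair; [rewrite addrC | rewrite -[RHS]addrA subrKC [y.2 + _]addrC].
Qed.

Lemma bext_expgE (w : W) n : (((0%R, w) : E) ^+ n)%g = (0, w *+ n) :> E.
Proof.
elim: n => [|n IHn]; first by rewrite mulr0n.
by rewrite expgS IHn bext_mulE /= beta0l !addr0 mulrS.
Qed.

Lemma bext_center (w : W) : ((0, w) : E) \in 'Z([set: E]).
Proof.
apply/centerP; split; first by rewrite inE.
by move=> y _; apply/commgP; rewrite bext_commgE /= beta0l beta0r subrr.
Qed.

Lemma bext_metabelian : metabelian [set: E].
Proof.
suff cZ : [set: E]^`(1)%g \subset 'Z([set: E]).
  exact: abelianS cZ (center_abelian _).
rewrite gen_subG; apply/subsetP=> _ /imset2P[x y _ _ ->].
by rewrite bext_commgE bext_center.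
Qed.

Lemma card_bext : #|[set: E]| = (#|V| * #|W|)%N.
Proof. by rewrite cardsT card_prod. Qed.

End CentralExtension.

Section Example.

Import GRing.Theory.
Local Open Scope ring_scope.

Variable p : nat.

Local Notation V := 'rV['F_p]_4.

Local Notation o0 := (@Ordinal 4 0 isT).
Local Notation o1 := (@Ordinal 4 1 isT).
Local Notation o2 := (@Ordinal 4 2 isT).
Local Notation o3 := (@Ordinal 4 3 isT).

(* The commutator has coordinates the minors [01], [23], [12], [13] of (x, y). *)
Definition four_minors_form (u v : V) : V :=
  \row_i (u 0 (tnth [tuple o0; o2; o1; o1] i) *
          v 0 (tnth [tuple o1; o3; o2; o3] i)).

Lemma four_minors_formDl u v x :
  four_minors_form (u + v) x = four_minors_form u x + four_minors_form v x.
Proof. by apply/rowP=> i; rewrite !mxE mulrDl. Qed.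

Lemma four_minors_formDr x u v :
  four_minors_form x (u + v) = four_minors_form x u + four_minors_form x v.
Proof. by apply/rowP=> i; rewrite !mxE mulrDr. Qed.

Definition four_minors_group : finGroupType :=
  bilinear_extension four_minors_formDl four_minors_formDr.

(** The vector (1, 1, 0, 0), which stands for the bivector e0^e1 + e2^e3. *)
Definition two_pairs : V := \row_i (i < 2)%:R.

Definition two_pairs_elt : four_minors_group := (0, two_pairs).

(** Two commutators of basis vectors supply the minors [01] and [23] separately, and their product
    combines them. *)
Lemma two_pairs_elt_der1 : two_pairs_elt \in [set: four_minors_group]^`(1)%g.
Proof.
have e i : (delta_mx 0 i, 0) \in [set: four_minors_group] by rewrite inE.
have -> : two_pairs_elt =
  ([~ (delta_mx 0 o0, 0) : four_minors_group, (delta_mx 0 o1, 0)] *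
   [~ (delta_mx 0 o2, 0) : four_minors_group, (delta_mx 0 o3, 0)])%g.
  rewrite !bext_commgE bext_mulE /= (beta0l four_minors_formDl).
  rewrite /two_pairs_elt !addr0; congr pair; apply/rowP=> i; rewrite !mxE.
  by case: i => [[|[|[|[|//]]]] ?];
    rewrite /= ?mul0r ?mulr0 ?mul1r ?subr0 ?addr0 ?add0r.
by rewrite groupM ?mem_commg.
Qed.

(* Pluecker: [01][23] = [02][13] - [03][12]. If the commutator is (n, n, 0, 0)
   this reads n ^ 2 = 0. *)
Lemma two_pairs_commg1 (x y : four_minors_group) :
  [~ x, y] \in <[two_pairs_elt]>%g -> [~ x, y] = 1%g.
Proof.
case/cycleP=> n; rewrite bext_commgE bext_expgE.
case=> /rowP dE; have dE' i := dE i; move: (dE' o0) (dE' o1) (dE' o2) (dE' o3).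
rewrite !mulmxnE !mxE /= !(tnth_nth o0) /= mul0rn => d0 d1 d2 d3.
have n0 : n%:R = 0 :> 'F_p.
  apply/eqP; rewrite -[_ == 0](orbb) -mulf_eq0 -{1}d0 -d1; apply/eqP.
  set x1 := x.1; set y1 := y.1.
  transitivity ((x1 0 o0 * y1 0 o2 - x1 0 o2 * y1 0 o0) *
                (x1 0 o1 * y1 0 o3 - y1 0 o1 * x1 0 o3) -
                (x1 0 o0 * y1 0 o3 - x1 0 o3 * y1 0 o0) *
                (x1 0 o1 * y1 0 o2 - y1 0 o1 * x1 0 o2)); first by ring.
  by rewrite d2 d3 !mulr0 subr0.
by congr pair; apply/rowP=> i; rewrite dE mulmxnE !mxE -[_ *+ n]mulr_natr n0 mulr0.
Qed.

End Example.

Theorem mainTheorem1 (p : nat) (p_prime : prime p) :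
  exists (gT : finGroupType) (G H : {group gT}),
    [/\ metabelian G,
        #|G| = (p ^ 8)%N,
        H \subset 'Z(G) :&: G^`(1),
        #|H| = p
      & exists T : {set gT},
          rcoset_transversal T H G /\ conj_invariant G T] /\
    (abelian H /\ H :&: G^`(1) != 1).
Proof.
have cardF : #|'F_p| = p by exact: card_Fp.
have oh : #[two_pairs_elt p] = p.
  apply: nt_prime_order => //.
    rewrite bext_expgE; congr pair; apply/rowP=> i.
    by rewrite mulmxnE !mxE -[GRing.natmul _ p]GRing.mulr_natr pchar_Fp_0 ?GRing.mulr0.
  (* Nontriviality is read off the entry at index 0, which is 1. *)
  apply/eqP; case=> /matrixP /(_ ord0 ord0) /eqP.
  by rewrite !mxE GRing.oner_eq0.
have hZ : <[two_pairs_elt p]> \subset 'Z([set: four_minors_group p]).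
  by rewrite cycle_subG; exact: bext_center.
have hG' : <[two_pairs_elt p]> \subset [set: four_minors_group p]^`(1).
  by rewrite cycle_subG two_pairs_elt_der1.
exists (four_minors_group p), [set: _]%G, <[two_pairs_elt p]>%G.
split; last first.
  split; first exact: cycle_abelian.
  by rewrite (setIidPl hG') -cardG_gt1 -orderE oh prime_gt1.
split=> //.
- exact: bext_metabelian.
- by rewrite card_bext !card_mx cardF -expnD.
- by rewrite subsetI hZ.
- apply: exists_conj_invariant_transversal => // x y _ _.
  exact: two_pairs_commg1.
Qed.
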